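(* Let $N\geq 1$, let $A\in M_N(\mathbb{C})$ and let $0<\epsilon<1$. If $\lambda\in\sigma_\epsilon(A)$, then $$|\lambda|\leq \frac{1+\epsilon}{1-\epsilon}\,\|A\|.$$
   Context: $M_N(\mathbb{C})$ is the algebra of complex $N\times N$ matrices; $\|\cdot\|$ is the Euclidean norm on $\mathbb{C}^N$ and the induced operator norm (spectral norm) on $M_N(\mathbb{C})$. For a scalar $z$, $z-A$ means $zI-A$. For $0<\epsilon<1$ the $\epsilon$-condition spectrum of $A$ is $$\sigma_\epsilon(A)=\{z\in\mathbb{C}: z-A \text{ is not invertible, or } \|(z-A)^{-1}\|\,\|z-A\|\geq 1/\epsilon\}.$$ *)

(* Defs.v *)
From mathcomp Require Import all_boot all_order all_algebra.
From mathcomp Require Import classical_sets reals.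
From mathcomp Require Export complex.
Set Implicit Arguments.
Unset Strict Implicit.
Unset Printing Implicit Defensive.
Import Order.TTheory GRing.Theory Num.Theory.
Local Open Scope classical_set_scope.
Local Open Scope ring_scope.

(* The modulus of a complex number is [Normc.normc : R[i] -> R]; the library's
   [`|z|] is the same number, but viewed inside [R[i]]. *)

(* Euclidean norm on column vectors; the canonical norm on matrices in
   MathComp-Analysis is the entrywise maximum. *)
Definition enorm (R : realType) (n : nat) (x : 'cV[R[i]]_n) : R :=
  Num.sqrt (\sum_(k < n) Normc.normc (x k ord0) ^+ 2).

(* The set is nonempty (it contains [0]) and bounded above, since [A] is
   finite-dimensional, so the default value of [sup] plays no role. *)
Definition opnorm (R : realType) (n : nat) (A : 'M[R[i]]_n) : R :=
  sup [set enorm (A *m x) | x in [set x : 'cV[R[i]]_n | enorm x <= 1]].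

(* [invmx B] is the junk value [B] when [B \notin unitmx]; this is harmless, as
   the first disjunct then holds. *)
Definition condition_spectrum (R : realType) (n : nat) (eps : R)
    (A : 'M[R[i]]_n) : set R[i] :=
  [set z | z%:M - A \notin unitmx \/
           1 / eps <= opnorm (invmx (z%:M - A)) * opnorm (z%:M - A)].

(* Main.v *)
Require Import Defs.
From mathcomp Require Import all_boot all_order all_algebra.
From mathcomp Require Import classical_sets reals.
From mathcomp Require Import lra.
Set Implicit Arguments.
Unset Strict Implicit.
Unset Printing Implicit Defensive.
Import Order.TTheory GRing.Theory Num.Theory.
Local Open Scope classical_set_scope.
Local Open Scope ring_scope.

(* If |lambda| <= ||A|| there is nothing to prove.  Otherwise
   ||(lambda - A) x|| >= (|lambda| - ||A||) ||x||, so lambda - A is invertible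
   with ||(lambda - A)^-1|| <= (|lambda| - ||A||)^-1.  Since also
   ||lambda - A|| <= |lambda| + ||A||, membership in the condition spectrum gives
   1 / eps <= (|lambda| + ||A||) / (|lambda| - ||A||), which rearranges to the
   claim. *)

Lemma normc_ge0 (R : rcfType) (z : R[i]) : 0 <= Normc.normc z.
Proof. by case: z => a b; exact: sqrtr_ge0. Qed.

Lemma normcD (R : rcfType) (z w : R[i]) :
  Normc.normc (z + w) <= Normc.normc z + Normc.normc w.
Proof. exact: (@le_normcD R z w). Qed.

(* The triangle inequality in R[i] is the planar Minkowski inequality, which is
   the induction step for Minkowski's inequality in any dimension. *)
Lemma minkowski_sum (R : rcfType) (I : finType) (f g h : I -> R)
    (h_ge0 : forall k, 0 <= h k) (h_le : forall k, h k <= f k + g k)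
    (f_ge0 : forall k, 0 <= f k) (g_ge0 : forall k, 0 <= g k) :
  Num.sqrt (\sum_k h k ^+ 2) <=
  Num.sqrt (\sum_k f k ^+ 2) + Num.sqrt (\sum_k g k ^+ 2).
Proof.
(* Nonnegativity of the partial sums travels with the inequality, because squaring their roots back
   requires it. *)
pose P (s t u : R) := [/\ 0 <= s, 0 <= t, 0 <= u
  & Num.sqrt s <= Num.sqrt t + Num.sqrt u].
suff [] : P (\sum_k h k ^+ 2) (\sum_k f k ^+ 2) (\sum_k g k ^+ 2) by [].
apply: (big_ind3 P); first by split; rewrite ?sqrtr0 ?addr0.
  move=> s1 t1 u1 s2 t2 u2 [s1_ge0 t1_ge0 u1_ge0 le1] [s2_ge0 t2_ge0 u2_ge0 le2].
  split; try exact: addr_ge0.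
  (* These two points have moduli [sqrt (t1 + t2)] and [sqrt (u1 + u2)]; by [le1] and [le2], the
     coordinates of their sum dominate [sqrt s1] and [sqrt s2]. *)
  have := normcD (Complex (Num.sqrt t1) (Num.sqrt t2))
                 (Complex (Num.sqrt u1) (Num.sqrt u2)).
  rewrite /Normc.normc /= !sqr_sqrtr //; apply: le_trans.
  rewrite ler_sqrt ?addr_ge0 ?sqr_ge0 //.
  rewrite -{1}(sqr_sqrtr s1_ge0) -{1}(sqr_sqrtr s2_ge0).
  by apply: lerD; rewrite ler_sqr ?nnegrE ?addr_ge0 ?sqrtr_ge0.
by move=> k _; split; rewrite ?sqr_ge0 // !sqrtr_sqr !ger0_norm.
Qed.

Lemma enorm_ge0 (R : realType) (n : nat) (x : 'cV[R[i]]_n) : 0 <= enorm x.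
Proof. exact: sqrtr_ge0. Qed.

Lemma enormD (R : realType) (n : nat) (x y : 'cV[R[i]]_n) :
  enorm (x + y) <= enorm x + enorm y.
Proof.
by apply: minkowski_sum => k; rewrite ?mxE ?normc_ge0 // normcD.
Qed.

Lemma enormZ (R : realType) (n : nat) (z : R[i]) (x : 'cV[R[i]]_n) :
  enorm (z *: x) = Normc.normc z * enorm x.
Proof.
rewrite /enorm; under eq_bigr do rewrite mxE Normc.normcM exprMn.
by rewrite -mulr_sumr sqrtrM ?sqr_ge0 // sqrtr_sqr ger0_norm ?normc_ge0.
Qed.

Lemma enorm0 (R : realType) (n : nat) : enorm (0 : 'cV[R[i]]_n) = 0.
Proof. by rewrite -(scale0r 0) enormZ Normc.normc0 mul0r. Qed.

Lemma enormN (R : realType) (n : nat) (x : 'cV[R[i]]_n) :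
  enorm (- x) = enorm x.
Proof. by rewrite /enorm; under eq_bigr do rewrite mxE normcN. Qed.

Lemma enormB_le (R : realType) (n : nat) (x y : 'cV[R[i]]_n) :
  enorm (x - y) <= enorm x + enorm y.
Proof. by rewrite -(enormN y) enormD. Qed.

Lemma enormB_ge (R : realType) (n : nat) (x y : 'cV[R[i]]_n) :
  enorm x - enorm y <= enorm (x - y).
Proof. by rewrite lerBlDr -{1}(subrK y x) enormD. Qed.

Lemma normc_le_enorm (R : realType) (n : nat) (x : 'cV[R[i]]_n) (k : 'I_n) :
  Normc.normc (x k ord0) <= enorm x.
Proof.
rewrite -(ger0_norm (normc_ge0 _)) -sqrtr_sqr /enorm ler_sqrt; last first.
  by apply: sumr_ge0 => j _; exact: sqr_ge0.
by rewrite (bigD1 k) //= lerDl sumr_ge0 // => j _; exact: sqr_ge0.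
Qed.

Lemma enorm_eq0 (R : realType) (n : nat) (x : 'cV[R[i]]_n) :
  enorm x <= 0 -> x = 0.
Proof.
move=> x_le0; apply/colP => k; rewrite [RHS]mxE; apply: Normc.eq0_normc.
by apply/le_anti; rewrite normc_ge0 (le_trans (normc_le_enorm x k)).
Qed.

Lemma enorm_sum (R : realType) (n : nat) (I : finType) (F : I -> 'cV[R[i]]_n) :
  enorm (\sum_k F k) <= \sum_k enorm (F k).
Proof.
elim/big_ind2: _ => [|x1 y1 x2 y2 le1 le2|k _]; rewrite ?enorm0 //.
by rewrite (le_trans (enormD _ _)) // lerD.
Qed.

(** On the unit ball every coordinate of [x] has modulus at most 1, so [A *m x], a combination of
    the columns of [A], is bounded by the sum of their norms. This makes the [sup] in [opnorm] a
    genuine upper bound. *)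
Lemma opnorm_has_ubound (R : realType) (n : nat) (A : 'M[R[i]]_n) :
  has_ubound [set enorm (A *m x) | x in [set x : 'cV[R[i]]_n | enorm x <= 1]].
Proof.
exists (\sum_k enorm (col k A)) => _ [x /= x_le1 <-].
have -> : A *m x = \sum_k x k ord0 *: col k A.
  apply/colP => j; rewrite mxE summxE; apply: eq_bigr => k _.
  by rewrite !mxE mulrC.
apply: le_trans (enorm_sum _) _; apply: ler_sum => k _.
by rewrite enormZ ler_piMl ?enorm_ge0 // (le_trans (normc_le_enorm x k)).
Qed.

Lemma enorm_mulmx_le_opnorm (R : realType) (n : nat) (A : 'M[R[i]]_n)
    (x : 'cV[R[i]]_n) :
  enorm x <= 1 -> enorm (A *m x) <= opnorm A.
Proof.
by move=> x_le1; apply: (ub_le_sup (opnorm_has_ubound A)); exists x.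
Qed.

Lemma opnorm_ge0 (R : realType) (n : nat) (A : 'M[R[i]]_n) : 0 <= opnorm A.
Proof.
rewrite -(enorm0 R n) -(mulmx0 _ A).
by apply: enorm_mulmx_le_opnorm; rewrite enorm0.
Qed.

Lemma enorm_mulmx (R : realType) (n : nat) (A : 'M[R[i]]_n)
    (x : 'cV[R[i]]_n) :
  enorm (A *m x) <= opnorm A * enorm x.
Proof.
have [/enorm_eq0 ->|x_gt0] := leP (enorm x) 0; first by rewrite mulmx0 !enorm0 mulr0.
(* The real factor normalizing [x], seen as a complex scalar so that it can act on vectors. *)
pose c : R[i] := Complex (enorm x)^-1 0.
have normc_c : Normc.normc c = (enorm x)^-1.
  by rewrite /= expr0n addr0 sqrtr_sqr ger0_norm // invr_ge0 enorm_ge0.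
have: enorm (A *m (c *: x)) <= opnorm A.
  by apply: enorm_mulmx_le_opnorm; rewrite enormZ normc_c mulVf ?gt_eqF.
by rewrite -scalemxAr enormZ normc_c mulrC ler_pdivrMr.
Qed.

Lemma opnorm_le (R : realType) (n : nat) (A : 'M[R[i]]_n) (c : R) :
  0 <= c -> (forall x, enorm (A *m x) <= c * enorm x) -> opnorm A <= c.
Proof.
move=> c_ge0 le_c; apply: ge_sup.
  (* The supremum is bounded only over a nonempty set; the zero vector provides a member. *)
  by exists (enorm (A *m 0)), 0; rewrite //= enorm0.
by move=> _ [x /= x_le1 <-]; rewrite (le_trans (le_c x)) // ler_piMr.
Qed.

Lemma opnorm_scalar_sub (R : realType) (n : nat) (A : 'M[R[i]]_n) (z : R[i]) :
  opnorm (z%:M - A) <= Normc.normc z + opnorm A.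
Proof.
apply: opnorm_le => [|x]; first by rewrite addr_ge0 ?normc_ge0 ?opnorm_ge0.
rewrite mulmxBl mul_scalar_mx mulrDl -enormZ.
by rewrite (le_trans (enormB_le _ _)) // lerD2l enorm_mulmx.
Qed.

Lemma enorm_scalar_sub_mulmx (R : realType) (n : nat) (A : 'M[R[i]]_n)
    (z : R[i]) (x : 'cV[R[i]]_n) :
  (Normc.normc z - opnorm A) * enorm x <= enorm ((z%:M - A) *m x).
Proof.
rewrite mulmxBl mul_scalar_mx mulrBl -enormZ.
by apply: le_trans (enormB_ge _ _); rewrite lerB ?enorm_mulmx.
Qed.

Section BoundedBelow.
Variables (R : realType) (n : nat) (B : 'M[R[i]]_n) (c : R).
Hypotheses (c_gt0 : 0 < c) (B_ge : forall x, c * enorm x <= enorm (B *m x)).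

(** The lower bound forces a trivial kernel, which suffices for a square matrix. Since [det0P]
    yields a row vector killed from the left, the argument passes through the transpose. *)
Lemma bounded_below_unitmx : B \in unitmx.
Proof.
rewrite unitmxE unitfE -det_tr; apply/det0P => -[v v_neq0 vB0].
have Bv0 : B *m v^T = 0 by rewrite -[B]trmxK -trmx_mul vB0 trmx0.
have := B_ge v^T; rewrite Bv0 enorm0 pmulr_rle0 // => /enorm_eq0 vT0.
by move: v_neq0; rewrite -[v]trmxK vT0 trmx0 eqxx.
Qed.

Lemma bounded_below_opnorm_invmx : opnorm (invmx B) <= c^-1.
Proof.
apply: opnorm_le => [|x]; first by rewrite invr_ge0 ltW.
(* The lower bound at the preimage of [x] becomes an upper bound for the inverse. *)
have := B_ge (invmx B *m x); rewrite mulKVmx ?bounded_below_unitmx //.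
by rewrite ler_pdivlMl.
Qed.

End BoundedBelow.

Theorem mainTheorem1 (R : realType) (N : nat) (hN : (1 <= N)%N)
    (A : 'M[R[i]]_N) (eps : R) (heps0 : 0 < eps) (heps1 : eps < 1)
    (lambda : R[i]) (hlambda : condition_spectrum eps A lambda) :
  Normc.normc lambda <= (1 + eps) / (1 - eps) * opnorm A.
Proof.
have A_ge0 := opnorm_ge0 A.
rewrite mulrAC ler_pdivlMr ?subr_gt0 //.
have [le_A|gt_A] := leP (Normc.normc lambda) (opnorm A).
  (* Factor by factor: [1 - eps <= 1 + eps] and the modulus is at most [opnorm A]. *)
  by rewrite [leLHS]mulrC; apply: ler_pM; rewrite ?normc_ge0 //; lra.
have gap_gt0 : 0 < Normc.normc lambda - opnorm A by rewrite subr_gt0.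
have B_ge := enorm_scalar_sub_mulmx A lambda.
case: hlambda => [|cond]; first by rewrite (bounded_below_unitmx gap_gt0 B_ge).
have prod_le : 1 / eps <=
    (Normc.normc lambda - opnorm A)^-1 * (Normc.normc lambda + opnorm A).
  apply: le_trans cond _; apply: ler_pM; rewrite ?opnorm_ge0 //.
    exact: bounded_below_opnorm_invmx.
  exact: opnorm_scalar_sub.
(* Clearing both denominators leaves [|lambda| - ||A|| <= (|lambda| + ||A||) * eps], which is the
   goal after collecting terms. *)
move: prod_le; rewrite ler_pdivlMl // mulrA ler_pdivrMr // mulr1; lra.
Qed.
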